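(* Let $S$ be a real-analytic finite-dimensional manifold, $\mathcal Z\to S$ a real-analytic vector bundle of finite rank, and $R:TS\to\mathcal Z$ a real-analytic vector bundle morphism (over the identity of $S$). For $0\le k\le\min\{\dim S,\operatorname{rank}\mathcal Z\}$ define $\mathcal D_k(R)=\{p\in S:\operatorname{rank}R_p\le k\}$. Then each $\mathcal D_k(R)$ is a closed real-analytic subset of $S$. Locally it is defined by the vanishing of the $(k+1)\times(k+1)$ minors of a matrix representative of $R$ (with respect to analytic local trivializations of $TS$ and $\mathcal Z$).
   Context: In the paper $S$ parameterizes a family of normalized Einstein metrics, $\mathcal Z$ is the observation bundle and $R$, with fibre maps $R_p:T_pS\to\mathcal Z_p$, is the response bundle morphism; only the data listed in the claim are used. A real-analytic subset of $S$ is a subset which, near each point of $S$, is the common zero set of finitely many real-analytic functions. *)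

(* Defs.v *)
From HB Require Import structures.
From mathcomp Require Import all_boot all_order all_algebra.
From mathcomp Require Import all_classical all_reals all_analysis.
Set Implicit Arguments.
Unset Strict Implicit.
Unset Printing Implicit Defensive.
Import Order.TTheory GRing.Theory Num.Theory.
Import numFieldNormedType.Exports.
Local Open Scope classical_set_scope.
Local Open Scope ring_scope.

(** * Real-analytic functions on open subsets of R^n *)

Section Analytic.
Variable R : realType.

(* Absolute (hence unconditional) convergence of the family u to s. *)
Definition has_sum (T : choiceType) (u : T -> R) (s : R) : Prop :=
  summable setT (EFin \o u) /\
  s%:E = (\esum_(t in setT) (EFin \o u)^\+ t
          - \esum_(t in setT) (EFin \o u)^\- t)%E.

Definition monomial (n : nat) (a : {ffun 'I_n -> nat}) (h : 'rV[R]_n) : R :=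
  \prod_i h 0 i ^+ a i.

(* Only the germ of f at x matters, so f may be junk away from x. *)
Definition analytic_at (n : nat) (f : 'rV[R]_n -> R) (x : 'rV[R]_n) : Prop :=
  exists (c : {ffun 'I_n -> nat} -> R) (r : R), 0 < r /\
    forall y, ball x r y -> has_sum (fun a => c a * monomial a (y - x)) (f y).

Definition analytic_map_at (n m : nat) (f : 'rV[R]_n -> 'rV[R]_m)
    (x : 'rV[R]_n) : Prop :=
  forall j, analytic_at (fun y => f y 0 j) x.

End Analytic.

(** * Real-analytic manifolds *)

(* The two maps are total; only their restrictions to [chart_dom] and to its
   image are meaningful. *)
Record chart (R : realType) (n : nat) (S : topologicalType) := Chart {
  chart_dom : set S;
  chart_map : S -> 'rV[R]_n;
  chart_inv : 'rV[R]_n -> S;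
  chart_dom_open : open chart_dom;
  chart_codom_open : open (chart_map @` chart_dom);
  chart_mapK : forall p, chart_dom p -> chart_inv (chart_map p) = p;
  chart_map_continuous : {within chart_dom, continuous chart_map};
  chart_inv_continuous :
    {within chart_map @` chart_dom, continuous chart_inv} }.

(* [chart_at] selects one chart around each point; it only serves to give a
   concrete model of the tangent spaces below. *)
Record analytic_manifold (R : realType) (n : nat) (S : topologicalType) :=
  AnalyticManifold {
  chart_idx : Type;
  mchart : chart_idx -> chart R n S;
  chart_at : S -> chart_idx;
  chart_atP : forall p, chart_dom (mchart (chart_at p)) p;
  transition_analytic : forall i j p,
    chart_dom (mchart i) p -> chart_dom (mchart j) p ->
    analytic_map_at (chart_map (mchart j) \o chart_inv (mchart i))
      (chart_map (mchart i) p);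
  manifold_hausdorff : hausdorff_space S;
  manifold_second_countable : @second_countable S }.

Section Functions.
Variables (R : realType) (n : nat) (S : topologicalType).
Variable M : analytic_manifold R n S.

(* Around each point of U, f is analytic when read in some chart; as the
   transition maps are analytic, the choice of the chart is immaterial. *)
Definition analytic_on (U : set S) (f : S -> R) : Prop :=
  forall p, U p -> exists2 i : chart_idx M, chart_dom (mchart i) p &
    \forall q \near p,
      analytic_at (f \o chart_inv (mchart i)) (chart_map (mchart i) q).

Definition analytic_subset (A : set S) : Prop :=
  forall p, exists (U : set S) (N : nat) (g : 'I_N -> S -> R),
    [/\ open U, U p, forall i, analytic_on U (g i) &
        A `&` U = [set q | U q /\ forall i, g i q = 0]].

End Functions.

(** * Real-analytic vector bundles *)

(* Fibres [E p] together with fibrewise linear maps to R^r. *)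
Record bundle_atlas (R : realType) (S : topologicalType) (r : nat)
    (E : S -> vectType R) := BundleAtlas {
  triv_idx : Type;
  triv_dom : triv_idx -> set S;
  triv : triv_idx -> forall p, 'Hom(E p, 'rV[R]_r) }.

(* A_p represents F_p on coordinate row vectors: it acts on the right, and so is
   the transpose of the matrix acting on columns.  Here ^-1 is the inverse of
   s p whenever s p is bijective. *)
Definition matrix_rep (R : realType) (S : topologicalType) (r r' : nat)
    (E E' : S -> vectType R) (s : forall p, 'Hom(E p, 'rV[R]_r))
    (t : forall p, 'Hom(E' p, 'rV[R]_r')) (F : forall p, 'Hom(E p, E' p))
    (p : S) : 'M[R]_(r, r') :=
  lin1_mx (fun v => t p (F p ((s p)^-1%VF v))).

Record vector_bundle (R : realType) (n : nat) (S : topologicalType)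
    (M : analytic_manifold R n S) (r : nat) (E : S -> vectType R) :=
  VectorBundle {
  vb_atlas :> bundle_atlas r E;
  vb_open : forall e : triv_idx vb_atlas, open (triv_dom e);
  vb_cover : forall p, exists e : triv_idx vb_atlas, triv_dom e p;
  vb_bijective : forall (e : triv_idx vb_atlas) p,
    triv_dom e p -> bijective (triv e p);
  vb_transition : forall (e e' : triv_idx vb_atlas) i j,
    analytic_on M (triv_dom e `&` triv_dom e')
      (fun p => matrix_rep (triv e) (triv e')
                  (fun q => \1%VF) p i j) }.

Section Bundles.
Variables (R : realType) (n : nat) (S : topologicalType).
Variable M : analytic_manifold R n S.

(* R^n, with v the coordinates of a tangent vector at p in the chart
   [chart_at M p]. *)
Definition tangent_space (p : S) : vectType R := 'rV[R]_n.

(* The differential at p of the chart i, for p in its domain. *)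
Definition chart_diff (i : chart_idx M) (p : S) :
    'Hom(tangent_space p, 'rV[R]_n) :=
  let c := mchart (chart_at M p) in
  linfun ('d (chart_map (mchart i) \o chart_inv c) (chart_map c p)).

Definition tangent_atlas : bundle_atlas n tangent_space :=
  BundleAtlas (fun i : chart_idx M => chart_dom (mchart i)) chart_diff.

Definition product_atlas (r : nat) : bundle_atlas r (fun _ : S => 'rV[R]_r) :=
  BundleAtlas (fun _ : unit => setT) (fun _ (_ : S) => \1%VF).

(* A chart i of S and a local trivialization e of E give the chart
   z in E p |-> (i p, e_p z) of the total space.  In such charts a morphism over
   the identity reads (x, v) |-> (x, local_rep (x, v)). *)
Definition local_rep (r r' : nat) (E E' : S -> vectType R)
    (B : bundle_atlas r E) (B' : bundle_atlas r' E')
    (F : forall p, 'Hom(E p, E' p)) (i : chart_idx M) (e : triv_idx B)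
    (e' : triv_idx B') (w : 'rV[R]_(n + r)) : 'rV[R]_r' :=
  let p := chart_inv (mchart i) (lsubmx w) in
  triv e' p (F p ((triv e p)^-1%VF (rsubmx w))).

(* F is analytic as a map between the total spaces over U. *)
Definition analytic_morphism_on (U : set S) (r r' : nat)
    (E E' : S -> vectType R) (B : bundle_atlas r E) (B' : bundle_atlas r' E')
    (F : forall p, 'Hom(E p, E' p)) : Prop :=
  forall p, U p -> exists (i : chart_idx M) (e : triv_idx B) (e' : triv_idx B'),
    [/\ chart_dom (mchart i) p, triv_dom e p, triv_dom e' p &
        \forall q \near p, forall v : 'rV[R]_r,
          analytic_map_at (local_rep F i e e')
            (row_mx (chart_map (mchart i) q) v)].

Definition analytic_morphism (r r' : nat) (E E' : S -> vectType R)
    (B : bundle_atlas r E) (B' : bundle_atlas r' E')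
    (F : forall p, 'Hom(E p, E' p)) : Prop :=
  analytic_morphism_on setT B B' F.

(* An analytic isomorphism, linear on fibres, from E over U to U x R^r. *)
Definition local_trivialization (r : nat) (E : S -> vectType R)
    (B : bundle_atlas r E) (U : set S)
    (s : forall p, 'Hom(E p, 'rV[R]_r)) : Prop :=
  [/\ open U, forall p, U p -> bijective (s p),
      analytic_morphism_on U B (product_atlas r) s &
      analytic_morphism_on U (product_atlas r) B (fun p => (s p)^-1%VF)].

End Bundles.

(** * Degeneracy loci and minors *)

Definition degeneracy_locus (R : realType) (S : topologicalType)
    (E E' : S -> vectType R) (F : forall p, 'Hom(E p, E' p)) (k : nat) : set S :=
  [set p | (\dim (limg (F p)) <= k)%N].

Definition increasing (k n : nat) (f : 'I_k -> 'I_n) : Prop :=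
  forall i j : 'I_k, (i < j)%N -> (f i < f j)%N.

Definition minor (R : realType) (m n k : nat) (f : 'I_k -> 'I_m)
    (g : 'I_k -> 'I_n) (A : 'M[R]_(m, n)) : R :=
  \det (mxsub f g A).

(* Main.v *)
(** A linear map has rank at most k iff all its (k+1)-minors vanish, and the
    minors of R in local frames are polynomials in its matrix entries.  Each
    entry is the analytic map (x, v) |-> local_rep (x, v) frozen at a basis
    vector v, so the minors are analytic; sums, products and partial evaluations
    of convergent multivariate power series are handled through absolutely
    convergent families.  The frames come from the atlases: for the tangent
    bundle they are the differentials of charts, invertible by the chain rule
    once analytic functions are known to be differentiable.  The same
    differentiability makes the minors continuous, hence the locus closed. *)

Require Import Defs.
From HB Require Import structures.
From mathcomp Require Import all_boot all_order all_algebra perm.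
From mathcomp Require Import all_classical all_reals all_analysis.
From mathcomp Require Import ring.
Set Implicit Arguments.
Unset Strict Implicit.
Unset Printing Implicit Defensive.
Import Order.TTheory GRing.Theory Num.Theory.
Import numFieldNormedType.Exports.
Local Open Scope classical_set_scope.
Local Open Scope ring_scope.

(** * Absolutely convergent families *)

Section NonnegativeSums.
Variable R : realType.

(** Equating the extended sum with a real [P] builds finiteness into the predicate. *)
Definition nneg_sum (T : choiceType) (p : T -> R) (P : R) : Prop :=
  (forall t, 0 <= p t) /\ \esum_(t in setT) (p t)%:E = P%:E.

Lemma nneg_sumD (T : choiceType) (p q : T -> R) P Q :
  nneg_sum p P -> nneg_sum q Q -> nneg_sum (fun t => p t + q t) (P + Q).
Proof.
move=> [p0 pP] [q0 qQ]; split; first by move=> t; exact: addr_ge0.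
under eq_esum do rewrite EFinD.
by rewrite esumD ?pP ?qQ// => t _; rewrite lee_fin.
Qed.

Lemma nneg_sumZ (T : choiceType) a (p : T -> R) P : 0 <= a ->
  nneg_sum p P -> nneg_sum (fun t => a * p t) (a * P).
Proof.
move=> a0 [p0 pP]; split; first by move=> t; exact: mulr_ge0.
rewrite EFinM -pP /esum -ereal_supZl//; last first.
  apply/set0P; exists (\sum_(x \in set0) (p x)%:E)%E; exists set0 => //.
congr ereal_sup; apply/seteqP; split=> [_ [X XT <-]|_ [_ [X XT <-] <-]].
  exists (\sum_(x \in X) (p x)%:E)%E; first by exists X.
  by rewrite ge0_mule_fsumr// => t; rewrite lee_fin.
by exists X => //; rewrite ge0_mule_fsumr// => t; rewrite lee_fin.
Qed.

Lemma nneg_sum_ge0 (T : choiceType) (p : T -> R) P : nneg_sum p P -> 0 <= P.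
Proof.
move=> [p0 pP]; rewrite -lee_fin -pP.
by apply: esum_ge0 => t _; rewrite lee_fin.
Qed.

Lemma nneg_sum_le (T : choiceType) (p q : T -> R) P Q :
  nneg_sum p P -> nneg_sum q Q -> (forall t, p t <= q t) -> P <= Q.
Proof.
by move=> [_ pP] [_ qQ] pq; rewrite -lee_fin -pP -qQ; apply: le_esum => t _;
  rewrite lee_fin.
Qed.

(** Tonelli: the sum over pairs is an iterated sum, from which [p t] and then [Q] factor out. *)
Lemma nneg_sum_mul (T T' : choiceType) (p : T -> R) (q : T' -> R) P Q :
  nneg_sum p P -> nneg_sum q Q ->
  nneg_sum (fun x : T * T' => p x.1 * q x.2) (P * Q).
Proof.
move=> pP qQ; have [p0 _] := pP; have [q0 _] := qQ.
split; first by move=> t; exact: mulr_ge0.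
transitivity (\esum_(t in [set: T]) \esum_(t' in [set: T']) (p t * q t')%:E)%E.
  rewrite esum_esum; last by move=> t t' _ _; rewrite lee_fin mulr_ge0.
  by congr esum; apply/seteqP.
under eq_esum => t _.
  have [_ ->] := nneg_sumZ (p0 t) qQ.
  rewrite mulrC.
  over.
by have [_ ->] := nneg_sumZ (nneg_sum_ge0 qQ) pP; rewrite mulrC.
Qed.

(** Both sides sum over the pairs [(phi t', t')], which the second projection matches bijectively
    with [T']. Finite fibres turn the inner extended sums into finite real ones. *)
Lemma nneg_sum_fibre (T T' : choiceType) (phi : T' -> T) (p : T' -> R) P :
  (forall t, finite_set (phi @^-1` [set t])) -> nneg_sum p P ->
  nneg_sum (fun t => \sum_(t' \in phi @^-1` [set t]) p t') P.
Proof.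
move=> fin [p0 pP]; split; first by move=> t; exact: fsumr_ge0.
transitivity
  (\esum_(t in [set: T]) \esum_(t' in phi @^-1` [set t]) (p t')%:E)%E.
  apply: eq_esum => t _; rewrite esum_fset//; last by move=> *; rewrite lee_fin.
  by rewrite fsumEFin.
rewrite esum_esum; last by move=> *; rewrite lee_fin.
rewrite -pP; apply/esym/(@reindex_esum _ _ _ _ _ snd); split=> //.
- by move=> [t t'] [u u'] /=; rewrite !inE/= => -[_ <-] [_ <-] <-.
- by move=> t' _; exists (phi t', t').
Qed.

Lemma nneg_sum_inj (T T' : choiceType) (phi : T -> T') (p : T' -> R) P :
  injective phi -> (forall t', ~ range phi t' -> p t' = 0) ->
  nneg_sum p P -> nneg_sum (p \o phi) P.
Proof.
move=> phiI p_out [p0 pP]; split=> [t|]; first exact: p0.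
rewrite -(esum_image setT phi (fun t' => (p t')%:E)); last exact: in2W phiI.
rewrite esum_mkcond -pP; apply: eq_esum => t' _.
case: ifPn => // /negP t'N; rewrite p_out// => rt.
by apply: t'N; exact: mem_set.
Qed.

Lemma nneg_sum_supp1 (T : choiceType) (t0 : T) (p : T -> R) :
  (forall t, 0 <= p t) -> (forall t, t != t0 -> p t = 0) -> nneg_sum p (p t0).
Proof.
move=> p0 pN; split=> //.
rewrite -(esum_set1 (a := fun t => (p t)%:E)) ?lee_fin//.
rewrite [RHS]esum_mkcond; apply: eq_esum => t _.
by case: ifPn => // /negP tN; rewrite pN//; apply/eqP => t0E; apply: tN;
  rewrite t0E inE.
Qed.

End NonnegativeSums.

(** * Signed families as differences of nonnegative ones *)

Section SignedSums.
Variable R : realType.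

Lemma maxr0B (x : R) : Num.max x 0 - Num.max (- x) 0 = x.
Proof.
case: (leP x 0) => x0; first by rewrite max_l ?oppr_ge0// opprK add0r.
by rewrite max_r ?subr0// oppr_le0 ltW.
Qed.

Lemma has_sum_posneg (T : choiceType) (u : T -> R) s : has_sum u s ->
  exists P Q, [/\ nneg_sum (fun t => Num.max (u t) 0) P,
    nneg_sum (fun t => Num.max (- u t) 0) Q & s = P - Q].
Proof.
move=> [us sE].
have pE t : ((EFin \o u)^\+ t)%E = (Num.max (u t) 0)%:E.
  by rewrite funeposE EFin_max.
have qE t : ((EFin \o u)^\- t)%E = (Num.max (- u t) 0)%:E.
  by rewrite funenegE EFin_max.
have fin_sum (v : T -> R) : (forall t, 0 <= v t) -> summable setT (EFin \o v) ->
    nneg_sum v (fine (\esum_(t in setT) (v t)%:E)%E).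
  move=> v0; rewrite summableE => vs; split=> //; rewrite fineK//.
  rewrite (@eq_esum _ _ _ _ (fun t => `|(EFin \o v) t|%E))// => t _ /=.
  by rewrite ger0_norm.
have pS := summable_funepos us; have qS := summable_funeneg us.
have pE' : (EFin \o u)^\+%E = EFin \o (fun t => Num.max (u t) 0).
  by apply/funext => t; rewrite pE.
have qE' : (EFin \o u)^\-%E = EFin \o (fun t => Num.max (- u t) 0).
  by apply/funext => t; rewrite qE.
rewrite pE' in pS; rewrite qE' in qS.
have max0 (x : R) : 0 <= Num.max x 0 by rewrite le_max lexx orbT.
have {}pS := fin_sum _ (fun t => max0 _) pS.
have {}qS := fin_sum _ (fun t => max0 _) qS.
do 2!eexists; split; [exact: pS|exact: qS|].
apply: EFin_inj; rewrite sE EFinB -(proj2 pS) -(proj2 qS).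
by congr (_ - _)%E; apply: eq_esum => t _; rewrite ?pE ?qE.
Qed.

(* Unlike the canonical positive and negative parts, such p and q are stable
   under sums, products and regrouping. *)
Lemma has_sumP (T : choiceType) (u : T -> R) s : has_sum u s <->
  exists p q P Q, [/\ nneg_sum p P, nneg_sum q Q, u = p \- q & s = P - Q].
Proof.
split=> [/has_sum_posneg[P [Q [pP qQ sE]]]|].
  exists (fun t => Num.max (u t) 0), (fun t => Num.max (- u t) 0), P, Q.
  by split=> //; apply/funext => t /=; rewrite maxr0B.
move=> [p [q [P [Q [[p0 pP] [q0 qQ] -> ->]]]]].
have sumv (v : T -> R) V : (forall t, 0 <= v t) ->
    (\esum_(t in setT) (v t)%:E)%E = V%:E -> summable setT (EFin \o v).
  move=> v0 vV; rewrite /summable (@eq_esum _ _ _ _ (fun t => (v t)%:E)).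
    by rewrite vV ltry.
  by move=> t _ /=; rewrite ger0_norm.
have ps := sumv _ _ p0 pP; have qs := sumv _ _ q0 qQ.
rewrite /has_sum (_ : EFin \o _ = ((EFin \o p) \- (EFin \o q))%E)//.
split; first exact: summableB.
by rewrite esumB// ?pP ?qQ// => t _ /=; rewrite lee_fin.
Qed.

Lemma has_sumD (T : choiceType) (u v : T -> R) s t :
  has_sum u s -> has_sum v t -> has_sum (fun x => u x + v x) (s + t).
Proof.
move=> /has_sumP[p [q [P [Q [pP qQ -> ->]]]]].
move=> /has_sumP[p' [q' [P' [Q' [pP' qQ' -> ->]]]]].
apply/has_sumP; exists (fun x => p x + p' x), (fun x => q x + q' x).
exists (P + P'), (Q + Q'); split; [exact: nneg_sumD|exact: nneg_sumD| |].
  by apply/funext => x /=; rewrite opprD addrACA.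
by rewrite opprD addrACA.
Qed.

Lemma has_sumN (T : choiceType) (u : T -> R) s :
  has_sum u s -> has_sum (fun x => - u x) (- s).
Proof.
move=> /has_sumP[p [q [P [Q [pP qQ -> ->]]]]]; apply/has_sumP.
exists q, p, Q, P; split=> //; last by rewrite opprB.
by apply/funext => x /=; rewrite opprB.
Qed.

Lemma has_sum_mul (T T' : choiceType) (u : T -> R) (v : T' -> R) s t :
  has_sum u s -> has_sum v t ->
  has_sum (fun x : T * T' => u x.1 * v x.2) (s * t).
Proof.
move=> /has_sumP[p [q [P [Q [pP qQ -> ->]]]]].
move=> /has_sumP[p' [q' [P' [Q' [pP' qQ' -> ->]]]]].
(* Grouping the four products by sign gives again a difference of two nonnegative families. *)
have expand (a b c d : R) :
    (a - b) * (c - d) = (a * c + b * d) - (a * d + b * c).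
  by ring.
apply/has_sumP; exists (fun x => p x.1 * p' x.2 + q x.1 * q' x.2).
exists (fun x => p x.1 * q' x.2 + q x.1 * p' x.2).
exists (P * P' + Q * Q'), (P * Q' + Q * P'); split; last exact: expand.
- by apply: nneg_sumD; exact: nneg_sum_mul.
- by apply: nneg_sumD; exact: nneg_sum_mul.
- by apply/funext => x /=; exact: expand.
Qed.

Lemma has_sum_fibre (T T' : choiceType) (phi : T' -> T) (u : T' -> R) s :
  (forall t, finite_set (phi @^-1` [set t])) -> has_sum u s ->
  has_sum (fun t => \sum_(t' \in phi @^-1` [set t]) u t') s.
Proof.
move=> fin /has_sumP[p [q [P [Q [pP qQ -> ->]]]]]; apply/has_sumP.
exists (fun t => \sum_(t' \in phi @^-1` [set t]) p t').
exists (fun t => \sum_(t' \in phi @^-1` [set t]) q t').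
exists P, Q; split=> //; [exact: nneg_sum_fibre|exact: nneg_sum_fibre|].
by apply/funext => t /=; rewrite !fsbig_finite// -sumrB.
Qed.

(** The canonical parts are taken here, not arbitrary [p] and [q]: they vanish wherever [u] does, as
    [nneg_sum_inj] demands. *)
Lemma has_sum_inj (T T' : choiceType) (phi : T -> T') (u : T' -> R) s :
  injective phi -> (forall t', ~ range phi t' -> u t' = 0) ->
  has_sum u s -> has_sum (u \o phi) s.
Proof.
move=> phiI u_out /has_sum_posneg[P [Q [pP qQ ->]]]; apply/has_sumP.
exists ((fun t => Num.max (u t) 0) \o phi).
exists ((fun t => Num.max (- u t) 0) \o phi), P, Q; split=> //.
- by apply: nneg_sum_inj pP => // t' /u_out ->; rewrite maxxx.
- by apply: nneg_sum_inj qQ => // t' /u_out ->; rewrite oppr0 maxxx.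
- by apply/funext => t /=; rewrite maxr0B.
Qed.

Lemma has_sum_supp1 (T : choiceType) (t0 : T) (u : T -> R) :
  (forall t, t != t0 -> u t = 0) -> has_sum u (u t0).
Proof.
move=> uN; apply/has_sumP.
exists (fun t => Num.max (u t) 0), (fun t => Num.max (- u t) 0).
exists (Num.max (u t0) 0), (Num.max (- u t0) 0); split.
- apply: (@nneg_sum_supp1 _ _ t0 (fun t => Num.max (u t) 0)) => t.
    by rewrite le_max lexx orbT.
  by move=> /uN ->; rewrite maxxx.
- apply: (@nneg_sum_supp1 _ _ t0 (fun t => Num.max (- u t) 0)) => t.
    by rewrite le_max lexx orbT.
  by move=> /uN ->; rewrite oppr0 maxxx.
- by apply/funext => t /=; rewrite maxr0B.
- by rewrite maxr0B.
Qed.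

Lemma has_sum_norm (T : choiceType) (u : T -> R) s :
  has_sum u s -> exists K, nneg_sum (fun t => `|u t|) K.
Proof.
move=> [us _]; exists (fine (\esum_(t in setT) `|(u t)%:E|)%E).
by split=> // ; rewrite fineK -?summableE.
Qed.

(** With [u = p - q], the bound says [q <= p + v] and [p <= v + q] termwise; comparing nonnegative
    sums gives the two inequalities. *)
Lemma has_sum_le (T : choiceType) (u v : T -> R) s K :
  has_sum u s -> nneg_sum v K -> (forall t, `|u t| <= v t) -> `|s| <= K.
Proof.
move=> /has_sumP[p [q [P [Q [pP qQ -> ->]]]]] vK uv.
rewrite ler_norml; apply/andP; split.
  rewrite lerBrDr addrC lerBlDr.
  apply: (nneg_sum_le qQ (nneg_sumD pP vK)) => t.
  have := uv t; rewrite ler_norml => /andP[+ _] /=.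
  by rewrite lerBrDr addrC lerBlDr.
rewrite lerBlDr.
apply: (nneg_sum_le pP (nneg_sumD vK qQ)) => t.
by have := uv t; rewrite ler_norml => /andP[_ +] /=; rewrite lerBlDr.
Qed.

Lemma has_sum_unique (T : choiceType) (u : T -> R) s t :
  has_sum u s -> has_sum u t -> s = t.
Proof. by move=> [_ sE] [_ tE]; apply: EFin_inj; rewrite sE tE. Qed.

Lemma has_sum_sum (T : choiceType) m (u : 'I_m -> T -> R) (s : 'I_m -> R) :
  (forall i, has_sum (u i) (s i)) ->
  has_sum (fun t => \sum_i u i t) (\sum_i s i).
Proof.
elim: m u s => [|m IH] u s us.
  rewrite big_ord0; apply/has_sumP; exists (fun _ => 0), (fun _ => 0), 0, 0.
  have z : nneg_sum (fun _ : T => 0 : R) 0.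
    by split=> //; rewrite esum1.
  by split=> //; [apply/funext => t /=; rewrite big_ord0 subr0|rewrite subr0].
rewrite big_ord_recl; under eq_fun do rewrite big_ord_recl.
exact: has_sumD (us _) (IH _ _ (fun i => us (lift ord0 i))).
Qed.

End SignedSums.

(** * Analytic functions on R^n *)

Section AnalyticFunctions.
Variable R : realType.

(** Taking a pair as argument makes the preimages of points the index sets of the Cauchy product. *)
Definition madd n (ab : {ffun 'I_n -> nat} * {ffun 'I_n -> nat}) :
  {ffun 'I_n -> nat} := [ffun i => (ab.1 i + ab.2 i)%N].

Lemma monomial_add n (a b : {ffun 'I_n -> nat}) (h : 'rV[R]_n) :
  monomial (madd (a, b)) h = monomial a h * monomial b h.
Proof.
by rewrite /monomial -big_split; apply: eq_bigr => i _; rewrite ffunE exprD.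
Qed.

(** Both summands are bounded entrywise by the total degree [N] of [a], so the fibre lies in the
    image of a finite box. *)
Lemma finite_madd_fibre n (a : {ffun 'I_n -> nat}) :
  finite_set (@madd n @^-1` [set a]).
Proof.
pose N := \sum_i a i; pose box := {ffun 'I_n -> 'I_N.+1}.
pose emb (x : box * box) : {ffun 'I_n -> nat} * {ffun 'I_n -> nat} :=
  ([ffun i => x.1 i : nat], [ffun i => x.2 i : nat]).
apply: (@sub_finite_set _ _ (range emb)); last first.
  exact/finite_image/finite_finset.
move=> [b c] /= bcE.
have bcN i : (b i + c i <= N)%N.
  have -> : (b i + c i = a i)%N by rewrite -bcE ffunE.
  by rewrite /N (bigD1 i)//= leq_addr.
exists ([ffun i => inord (b i)], [ffun i => inord (c i)]) => //.
by rewrite /emb/=; congr pair; apply/ffunP => i; rewrite !ffunE inordK// ltnS;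
  apply: leq_trans (bcN i); rewrite ?leq_addr ?leq_addl.
Qed.

Lemma analytic_at_near n (f g : 'rV[R]_n -> R) x :
  (\forall y \near x, f y = g y) -> analytic_at f x -> analytic_at g x.
Proof.
move=> /nbhs_ballP[e /= e0 fg] [c [r [r0 cr]]].
exists c, (Num.min r e); split=> [|y xy]; first by rewrite lt_min r0.
rewrite -fg; first by apply: cr; apply: le_ball xy; rewrite ge_min lexx.
by apply: le_ball xy; rewrite ge_min lexx orbT.
Qed.

Lemma analytic_at_supp1 n (a0 : {ffun 'I_n -> nat}) k (x : 'rV[R]_n) :
  analytic_at (fun y => k * monomial a0 (y - x)) x.
Proof.
exists (fun a => k *+ (a == a0)), 1; split=> // y _.
have := @has_sum_supp1 R _ a0 (fun a => k *+ (a == a0) * monomial a (y - x)).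
by rewrite eqxx; apply=> t /negPf ->; rewrite mul0r.
Qed.

Lemma analytic_at_cst n k (x : 'rV[R]_n) : analytic_at (fun _ => k) x.
Proof.
have := analytic_at_supp1 [ffun => 0%N] k x; congr analytic_at.
apply/funext => y; rewrite /monomial big1 ?mulr1// => i _.
by rewrite ffunE expr0.
Qed.

Definition mdelta n (j : 'I_n) : {ffun 'I_n -> nat} :=
  [ffun i => (i == j) : nat].

Lemma monomial_delta n (j : 'I_n) (h : 'rV[R]_n) :
  monomial (mdelta j) h = h 0 j.
Proof.
rewrite /monomial (bigD1 j)//= ffunE eqxx expr1 big1 ?mulr1// => i /negPf ij.
by rewrite ffunE ij.
Qed.

Lemma analytic_atD n (f g : 'rV[R]_n -> R) x :
  analytic_at f x -> analytic_at g x -> analytic_at (fun y => f y + g y) x.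
Proof.
move=> [c [r [r0 cr]]] [c' [r' [r'0 cr']]].
exists (fun a => c a + c' a), (Num.min r r'); split=> [|y xy].
  by rewrite lt_min r0.
under eq_fun do rewrite mulrDl.
apply: has_sumD; first by apply: cr; apply: le_ball xy; rewrite ge_min lexx.
by apply: cr'; apply: le_ball xy; rewrite ge_min lexx orbT.
Qed.

(** Cauchy product: the family of products over pairs of exponents is regrouped along [madd]. *)
Lemma analytic_atM n (f g : 'rV[R]_n -> R) x :
  analytic_at f x -> analytic_at g x -> analytic_at (fun y => f y * g y) x.
Proof.
move=> [c [r [r0 cr]]] [c' [r' [r'0 cr']]].
exists (fun a => \sum_(bc \in @madd n @^-1` [set a]) c bc.1 * c' bc.2).
exists (Num.min r r'); split=> [|y xy].
  by rewrite lt_min r0.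
have rl : Num.min r r' <= r by rewrite ge_min lexx.
have rl' : Num.min r r' <= r' by rewrite ge_min lexx orbT.
have fs := cr y (le_ball rl xy); have gs := cr' y (le_ball rl' xy).
have := has_sum_fibre (@finite_madd_fibre n) (has_sum_mul fs gs).
congr has_sum; apply/funext => a; rewrite mulr_fsuml.
apply: eq_fsbigr => -[b d]; rewrite inE/= => <-.
by rewrite monomial_add mulrACA.
Qed.

Lemma analytic_at_coord n (j : 'I_n) (x : 'rV[R]_n) :
  analytic_at (fun y => y 0 j) x.
Proof.
(* Expansion about [x]: the coordinate is [x 0 j] plus the degree-one monomial in [y - x]. *)
have := analytic_atD (analytic_at_cst (x 0 j) x)
  (analytic_at_supp1 (mdelta j) 1 x).
congr analytic_at; apply/funext => y.
by rewrite monomial_delta mul1r !mxE; ring.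
Qed.

Lemma analytic_at_sum n (I : Type) (s : seq I) (f : I -> 'rV[R]_n -> R) x :
  (forall i, analytic_at (f i) x) ->
  analytic_at (fun y => \sum_(i <- s) f i y) x.
Proof.
move=> fx; elim: s => [|i s IH].
  by under eq_fun do rewrite big_nil; exact: analytic_at_cst.
by under eq_fun do rewrite big_cons; exact: analytic_atD.
Qed.

Lemma analytic_at_prod n (I : Type) (s : seq I) (f : I -> 'rV[R]_n -> R) x :
  (forall i, analytic_at (f i) x) ->
  analytic_at (fun y => \prod_(i <- s) f i y) x.
Proof.
move=> fx; elim: s => [|i s IH].
  by under eq_fun do rewrite big_nil; exact: analytic_at_cst.
by under eq_fun do rewrite big_cons; exact: analytic_atM.
Qed.

(** Leibniz formula: the determinant is a finite sum of signed products of entries. *)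
Lemma analytic_at_det n m (A : 'rV[R]_n -> 'M[R]_m) x :
  (forall i j, analytic_at (fun y => A y i j) x) ->
  analytic_at (fun y => \det (A y)) x.
Proof.
move=> Ax; apply: analytic_at_sum => s; apply: analytic_atM.
  exact: analytic_at_cst.
exact: analytic_at_prod.
Qed.

Definition mext n r (a : {ffun 'I_n -> nat}) : {ffun 'I_(n + r) -> nat} :=
  [ffun k : 'I_(n + r) =>
    match fintype.split k with inl i => a i | inr _ => 0%N end].

Lemma mext_lshift n r (a : {ffun 'I_n -> nat}) i : mext r a (lshift r i) = a i.
Proof. by rewrite ffunE; rewrite (fintype.unsplitK (inl i)). Qed.

Lemma mext_rshift n r (a : {ffun 'I_n -> nat}) i : mext r a (rshift n i) = 0%N.
Proof. by rewrite ffunE; rewrite (fintype.unsplitK (inr i)). Qed.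

(** With [v] frozen the increment is [row_mx (y - x) 0], which kills every monomial involving one of
    the last [r] variables; the surviving exponents are the range of [mext]. *)
Lemma analytic_at_row_mx n r (F : 'rV[R]_(n + r) -> R) x v :
  analytic_at F (row_mx x v) -> analytic_at (fun y => F (row_mx y v)) x.
Proof.
move=> [c [e [e0 ce]]]; exists (c \o mext r), e; split=> // y xy.
have {}ce : has_sum (fun a => c a * monomial a (row_mx (y - x) 0))
    (F (row_mx y v)).
  have := ce (row_mx y v); rewrite opp_row_mx add_row_mx subrr; apply.
  case: xy => _ xy; split=> // i j; rewrite -(fintype.splitK j).
  by case: fintype.split => k /=; rewrite ?row_mxEl ?row_mxEr//; exact: ballxx.
have extI : injective (@mext n r).
  move=> a b /ffunP ab; apply/ffunP => i.
  by have := ab (lshift r i); rewrite !mext_lshift.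
have := has_sum_inj extI _ ce; rewrite (_ : _ \o _ =
  (fun a => (c \o mext r) a * monomial a (y - x))); last first.
  apply/funext => a /=; congr (_ * _); rewrite /monomial big_split_ord/=.
  rewrite [X in _ * X]big1 ?mulr1; last by move=> i _; rewrite mext_rshift.
  by apply: eq_bigr => i _; rewrite mext_lshift row_mxEl.
apply=> a aN; apply/eqP; rewrite mulf_eq0; apply/orP; right.
have [i ai] : exists i, a (rshift n i) != 0%N.
  apply/not_existsP => a0; apply: aN.
  exists [ffun i => a (lshift r i)] => //; apply/ffunP => k.
  rewrite -(fintype.splitK k); case: fintype.split => i /=.
    by rewrite mext_lshift ffunE.
  by rewrite mext_rshift; apply/esym/eqP; have /negP := a0 i; rewrite negbK.
rewrite /monomial; apply/prodf_eq0; exists (rshift n i) => //.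
by rewrite row_mxEr mxE expr0n (negPf ai).
Qed.

(** The bound forces [g x = 0] and makes [g] an [o(h)], so the zero map is its differential. *)
Lemma differentiable_quadratic (V : normedModType R) (g : V -> R) x C :
  (\forall y \near x, `|g y| <= C * `|y - x| ^+ 2) -> differentiable g x.
Proof.
move=> gC; have gx : g x = 0.
  apply/eqP; rewrite -normr_le0; have := nbhs_singleton gC.
  by rewrite subrr normr0 expr0n mulr0.
have gE : g \o shift x = cst (g x) + (\0 : V -> R) +o_ 0 id.
  apply/eqaddoP => _/posnumP[e]; near=> h.
  rewrite /= gx; rewrite (_ : _ h = g (h + x)); last first.
    rewrite /= opprD -![(_ + _ : _ -> _) _]/(_ + _).
    by rewrite -![(- _ : _ -> _) _]/(- _) /= !oppr0 !addr0.
  have : `|g (h + x)| <= C * `|h + x - x| ^+ 2.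
    near: h; move: gC; rewrite (near_shift 0 x) /=.
    by apply: filterS => z /=; rewrite subr0.
  rewrite addrK => /le_trans; apply; rewrite expr2 mulrA ler_wpM2r//.
  apply: (le_trans (y := `|C| * `|h|)).
    by rewrite ler_wpM2r// ler_norm.
  (* Adding 1 gives a positive constant to divide by, whatever the sign or vanishing of [C]. *)
  have C1 : 0 < `|C| + 1 by rewrite ltr_pwDr.
  apply: (le_trans (y := (`|C| + 1) * `|h|)).
    by rewrite ler_wpM2r// lerDl.
  rewrite -ler_pdivlMl//.
have c0 : continuous (\0 : V -> R) by move=> y; exact: cvg_cst.
by apply/diff_locallyP; rewrite (@diff_unique _ _ _ g \0 x).
Unshelve. all: by end_near. Qed.

End AnalyticFunctions.

(** * Differentiability of analytic functions *)

Section AnalyticDifferentiable.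
Variable R : realType.

Lemma rV_coord_le n (h : 'rV[R]_n) i : `|h 0 i| <= `|h|.
Proof.
rewrite [leRHS]/Num.norm/= mx_normrE.
exact: (le_bigmax _ (fun ij : 'I_1 * 'I_n => `|h ij.1 ij.2|) (0, i)).
Qed.

Definition mdeg n (a : {ffun 'I_n -> nat}) : nat := (\sum_i a i)%N.

Lemma monomial_le n (a : {ffun 'I_n -> nat}) (h : 'rV[R]_n) :
  `|monomial a h| <= `|h| ^+ mdeg a.
Proof.
rewrite /monomial normr_prod -prodrXr; apply: ler_prod => i _.
by rewrite normrX exprn_ge0//= lerXn2r ?nnegrE// rV_coord_le.
Qed.

(** At a vector with equal coordinates a monomial depends only on its degree, so absolute
    convergence there controls the coefficients by total degree. *)
Lemma monomial_const n (a : {ffun 'I_n -> nat}) (t : R) :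
  monomial a (const_mx t) = t ^+ mdeg a.
Proof. by rewrite /monomial -prodrXr; apply: eq_bigr => i _; rewrite mxE. Qed.

Lemma mdeg_lt2 n (a : {ffun 'I_n -> nat}) : (mdeg a < 2)%N ->
  a = [ffun => 0%N] \/ exists j, a = mdelta j.
Proof.
move=> a2; have [[j aj]|a0] := pselect (exists j, a j != 0%N); last first.
  left; apply/ffunP => i; rewrite ffunE; apply: contra_notP a0 => /eqP ai.
  by exists i.
right; exists j; apply/ffunP => i; move: a2.
rewrite /mdeg (bigD1 j)//= ffunE; case: (eqVneq i j) => [->|ij].
  by move: aj; case: (a j) => [//|[//|k]] _; rewrite !addSn.
rewrite (bigD1 i)//=; move: aj; case: (a j) => // k _; case: (a i) => // l.
by rewrite addSn addnCA addSn.
Qed.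

(** Removing the constant and linear terms leaves monomials of degree at least 2, dominated by a
    convergent family with a factor [|y - x| ^+ 2] in front. *)
Lemma analytic_at_taylor1 n (f : 'rV[R]_n -> R) x : analytic_at f x ->
  exists (L : 'I_n -> R) C, \forall y \near x,
    `|f y - f x - \sum_i L i * (y - x) 0 i| <= C * `|y - x| ^+ 2.
Proof.
move=> [c [r [r0 cr]]]; pose rho := r / 2.
(* Halving [r] puts the vector with all coordinates offset by [rho] strictly inside the ball of
   convergence. *)
have rho0 : 0 < rho by rewrite divr_gt0.
have rho_r : rho < r by rewrite ltr_pdivrMr// ltr_pMr// ltr1n.
have [K K_sum] : exists K, nneg_sum (fun a => `|c a| * rho ^+ mdeg a) K.
  have /cr/has_sum_norm[K] : ball x r (x + const_mx rho).
    split=> // i j; rewrite !mxE /ball/= opprD addNKr normrN gtr0_norm//.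
  rewrite addrC addKr => K_sum; exists K; move: K_sum; congr nneg_sum.
  apply/funext => a.
  by rewrite monomial_const normrM (ger0_norm (exprn_ge0 _ (ltW _))).
(* At the centre every monomial but the constant one vanishes. *)
have c0 : f x = c [ffun => 0%N].
  have := cr x (ballxx _ r0); rewrite subrr => fx; apply: has_sum_unique fx _.
  have -> : c [ffun => 0%N] =
      c [ffun => 0%N] * monomial [ffun => 0%N] (0 : 'rV[R]_n).
    by rewrite /monomial big1 ?mulr1// => i _; rewrite ffunE expr0.
  apply: (@has_sum_supp1 _ _ _ (fun a => c a * monomial a 0)) => a aN0.
  have [i ai] : exists i, a i != 0%N.
    apply/not_existsP => a0; move/eqP: aN0; apply; apply/ffunP => i.
    by rewrite ffunE; apply/eqP; have /negP := a0 i; rewrite negbK.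
  rewrite (_ : monomial a 0 = 0) ?mulr0//; apply/eqP/prodf_eq0; exists i => //.
  by rewrite mxE expr0n (negPf ai).
exists (fun i => c (mdelta i)), (K / rho ^+ 2).
have := nbhsx_ballx x rho rho0; apply: filterS => y xy.
pose h := y - x.
have h_rho : `|h| < rho.
  by move: xy; rewrite -ball_normE /= distrC.
(* Each subtracted term is placed at its own exponent by an indicator, so the Taylor remainder is
   the sum of one family. *)
pose v a := c a * monomial a h - c a *+ (a == [ffun => 0%N])
  - \sum_i c (mdelta i) * h 0 i *+ (a == mdelta i).
have v_sum : has_sum v (f y - f x - \sum_i c (mdelta i) * h 0 i).
  apply: has_sumD; first apply: has_sumD.
  - by apply: cr; apply: le_ball xy; exact: ltW.
  - rewrite c0; apply: has_sumN.
    have := @has_sum_supp1 R _ [ffun => 0%N]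
      (fun a : {ffun 'I_n -> nat} => c a *+ (a == [ffun => 0%N])).
    by rewrite eqxx; apply=> a /negPf ->.
  - apply: has_sumN; apply: has_sum_sum => i.
    have := @has_sum_supp1 R _ (mdelta i)
      (fun a : {ffun 'I_n -> nat} => c (mdelta i) * h 0 i *+ (a == mdelta i)).
    by rewrite eqxx; apply=> a /negPf ->.
(* Monomials of degree d >= 2: |h|^d <= (|h| / rho)^2 rho^d. *)
have v_le a : `|v a| <= (`|h| / rho) ^+ 2 * (`|c a| * rho ^+ mdeg a).
  have rhs0 : 0 <= (`|h| / rho) ^+ 2 * (`|c a| * rho ^+ mdeg a).
    by rewrite mulr_ge0 ?sqr_ge0// mulr_ge0// exprn_ge0// ltW.
  have dN0 i : mdelta i != [ffun => 0%N] :> {ffun 'I_n -> nat}.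
    by apply/eqP => /ffunP/(_ i); rewrite !ffunE eqxx.
  have dI i j : (mdelta i == mdelta j) = (i == j).
    apply/eqP/eqP => [/ffunP/(_ i)|->//]; rewrite !ffunE eqxx.
    by case: eqVneq.
  have [a2|a2] := ltnP (mdeg a) 2.
    rewrite (_ : v a = 0) ?normr0//; rewrite /v.
    have [->|[j ->]] := mdeg_lt2 a2.
      rewrite eqxx mulr1n big1 ?subr0; last first.
        by move=> i _; rewrite eq_sym (negPf (dN0 i)).
      by rewrite /monomial big1 ?mulr1 ?subrr// => i _; rewrite ffunE expr0.
    rewrite (negPf (dN0 j)) subr0 monomial_delta (bigD1 j)//= eqxx mulr1n.
    rewrite big1 ?addr0 ?subrr// => i ij.
    by rewrite dI eq_sym (negPf ij).
  have -> : v a = c a * monomial a h.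
    rewrite /v (_ : (a == _) = false) ?subr0; last first.
      apply/negP => /eqP aE; move: a2; rewrite aE /mdeg big1// => i _.
      by rewrite ffunE.
    rewrite big1 ?subr0// => i _; case: eqP => // aE; move: a2; rewrite aE.
    rewrite /mdeg (bigD1 i)//= ffunE eqxx big1// => j /negPf ij.
    by rewrite ffunE ij.
  rewrite normrM mulrCA ler_wpM2l//; apply: (le_trans (monomial_le _ _)).
  rewrite -(subnK a2) addnC !exprD mulrA exprMn exprVn.
  rewrite divfK ?expf_neq0 ?gt_eqF//.
  by rewrite ler_wpM2l ?exprn_ge0// lerXn2r ?nnegrE// ltW.
have := has_sum_le v_sum (nneg_sumZ (sqr_ge0 _) K_sum) v_le.
by rewrite exprMn exprVn mulrC mulrA mulrAC.
Qed.

(** The function is a constant, plus a linear combination of coordinates of [y - x], plus a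
    quadratically small remainder. *)
Lemma analytic_at_differentiable n (f : 'rV[R]_n -> R) x :
  analytic_at f x -> differentiable f x.
Proof.
move=> /analytic_at_taylor1[L [C fC]].
pose g y := f y - f x - \sum_i L i * (y - x) 0 i.
have -> : f = cst (f x) + \sum_(i < n) (fun y => L i *: ((y - x) 0 i : R)) + g.
  apply/funext => y; rewrite -![(_ + _ : _ -> _) _]/(_ + _) fct_sumE /g/=.
  by ring.
apply: differentiableD; last exact: differentiable_quadratic fC.
apply: differentiableD; first exact: differentiable_cst.
apply: differentiable_sum => i; apply: differentiableZ.
rewrite (_ : (fun y => _) = (fun y : 'rV[R]_n => y 0 i) - cst (x 0 i)).
  apply: differentiableB; last exact: differentiable_cst.
  exact: differentiable_coord.
by apply/funext => y; rewrite !mxE.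
Qed.

Lemma analytic_map_at_differentiable n m (f : 'rV[R]_n -> 'rV[R]_m) x :
  analytic_map_at f x -> differentiable f x.
Proof.
move=> fx; have -> : f = \sum_(j < m) (fun y => f y 0 j *: delta_mx 0 j).
  by apply/funext => y; rewrite fct_sumE [LHS]row_sum_delta.
apply: differentiable_sum => j; apply: differentiableZl.
exact: analytic_at_differentiable.
Qed.

End AnalyticDifferentiable.

(** * Rank and minors *)

Section Minors.
Variable R : realType.

(** The submatrix factors through [A], so its rank is at most that of [A], while a nonzero
    determinant would force rank [k.+1]. *)
Lemma minor_rank_le m n k (f : 'I_k.+1 -> 'I_m) (g : 'I_k.+1 -> 'I_n)
    (A : 'M[R]_(m, n)) :
  (\rank A <= k)%N -> minor f g A = 0.
Proof.
move=> Ak; apply/eqP; apply: contraLR Ak; rewrite -ltnNge => minor0.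
have : mxsub f g A \in unitmx by rewrite unitmxE unitfE.
rewrite -row_free_unit => /eqP {1}<-.
rewrite (_ : mxsub f g A = rowsub f 1%:M *m A *m colsub g 1%:M).
  exact: leq_trans (mxrankM_maxl _ _) (mxrankM_maxr _ _).
rewrite mul_rowsub_mx mul1mx mulmx_colsub mulmx1.
by apply/matrixP => i j; rewrite !mxE.
Qed.

(** Selecting the matching columns of a right inverse of [A] gives a right inverse of the selected
    rows. *)
Lemma injective_rowsub_free m n k (h : 'I_k -> 'I_m) (A : 'M[R]_(m, n)) :
  injective h -> row_free A -> row_free (rowsub h A).
Proof.
move=> hI /row_freeP[B AB]; apply/row_freeP; exists (colsub h B).
rewrite mul_rowsub_mx mulmx_colsub AB; apply/matrixP => i j.
by rewrite !mxE (inj_eq hI).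
Qed.

(** Take [k] rows from a maximal independent set; the resulting matrix has rank [k], so [k] of its
    columns form an invertible block. *)
Lemma exists_minor_neq0 m n k (A : 'M[R]_(m, n)) : (k <= \rank A)%N ->
  exists (f : 'I_k -> 'I_m) (g : 'I_k -> 'I_n),
    [/\ injective f, injective g & \det (mxsub f g A) != 0].
Proof.
move=> kA; pose f := maxrankfun A \o widen_ord kA.
have fI : injective f.
  by move=> i j /maxrankfun_inj/(congr1 val)/= /val_inj.
have fA : row_free (rowsub f A).
  rewrite (_ : rowsub f A = rowsub (widen_ord kA) (rowsub (maxrankfun A) A)).
    apply: injective_rowsub_free (maxrowsub_free A).
    by move=> i j /(congr1 val)/= /val_inj.
  by apply/matrixP => i j; rewrite !mxE.
have fT : row_full (rowsub f A)^T by rewrite /row_full mxrank_tr.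
exists f, (fullrankfun fT); split=> //; first exact: fullrankfun_inj.
have := fullrowsub_full fT; rewrite -unitfE -unitmxE -row_free_unit.
rewrite row_full_unit -unitmx_tr row_free_unit.
by congr (_ \in unitmx); apply/matrixP => i j; rewrite !mxE.
Qed.

(** [f'] lists the image of [f] in increasing order, and the permutation sends [i] to the position
    of [f i] in that list. *)
Lemma injective_sort n k (f : 'I_k -> 'I_n) : injective f ->
  exists (f' : 'I_k -> 'I_n) (s : 'S_k), increasing f' /\ f =1 f' \o s.
Proof.
move=> fI; pose X := mem (codom f).
have Xk : size (enum X) = k.
  by rewrite -cardE card_codom// card_ord.
have fX i : f i \in enum X by rewrite mem_enum codom_f.
have fXlt i : (index (f i) (enum X) < size (enum X))%N by rewrite index_mem fX.
pose s i : 'I_k := cast_ord Xk (Ordinal (fXlt i)).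
have sI : injective s.
  move=> i j /(congr1 val)/= ij; apply: fI.
  by rewrite -(nth_index (f i) (fX i)) ij nth_index.
(* The value [f i] is only a default for [nth]; every index used is within range. *)
exists (fun i => nth (f i) (enum X) i), (perm sI); split=> [i j ij|i].
  have srt : sorted ltn (map val (enum X)).
    apply: (subseq_sorted ltn_trans) (iota_ltn_sorted 0 n).
    by rewrite -val_enum_ord map_subseq// enumT filter_subseq.
  have := sorted_ltn_nth ltn_trans 0%N srt.
  move=> /(_ i j); rewrite !inE size_map Xk !ltn_ord => /(_ isT isT ij).
  by rewrite (nth_map (f i)) ?Xk// (nth_map (f j)) ?Xk.
by rewrite /= permE /= nth_index.
Qed.

(** Sorting the row and column choices of a nonzero minor multiplies it by determinants of
    permutation matrices, so increasing choices detect the rank. *)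
Lemma rank_le_minorsP m n k (A : 'M[R]_(m, n)) : (\rank A <= k)%N <->
  forall (f : 'I_k.+1 -> 'I_m) (g : 'I_k.+1 -> 'I_n),
    increasing f -> increasing g -> minor f g A = 0.
Proof.
split=> [Ak f g _ _|minors0]; first exact: minor_rank_le.
rewrite leqNgt; apply/negP => /exists_minor_neq0[f [g [fI gI]]] /negP; apply.
have [f' [s [f'inc fE]]] := injective_sort fI.
have [g' [t [g'inc gE]]] := injective_sort gI.
have -> : mxsub f g A = row_perm s (col_perm t (mxsub f' g' A)).
  by apply/matrixP => i j; rewrite !mxE fE gE.
rewrite row_permE col_permE !det_mulmx.
by have := minors0 _ _ f'inc g'inc; rewrite /minor => ->; rewrite mul0r mulr0.
Qed.

Lemma rank_lin1_mx m n (phi : 'Hom('rV[R]_m, 'rV[R]_n)) :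
  \rank (lin1_mx phi) = \dim (limg phi).
Proof.
set A := lin1_mx phi.
(* A basis of the row space parameterizes the image of [phi] injectively by a space of dimension
   [\rank A]. *)
pose beta : 'Hom('rV[R]_(\rank A), 'rV[R]_n) := linfun (mulmxr (row_base A)).
have -> : limg phi = limg beta.
  apply/vspaceP => v; apply/memv_imgP/memv_imgP => -[u _ ->].
    have : (phi u <= row_base A)%MS by rewrite eq_row_base -mul_rV_lin1 submxMl.
    by move=> /submxP[w ->]; exists w; rewrite ?memvf// lfunE.
  have : (beta u <= A)%MS by rewrite lfunE/= -(eq_row_base A) submxMl.
  by move=> /submxP[w ->]; exists w; rewrite ?memvf// mul_rV_lin1.
rewrite limg_dim_eq ?dimvf ?dim_matrix; first by rewrite mul1r.
apply/eqP.
suff /eqP -> : lker beta == 0%VS by rewrite capv0.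
apply/lker0P => u v; rewrite !lfunE/=.
exact: (row_free_inj (row_base_free A)).
Qed.

Lemma bijective_lker0 (V W : vectType R) (f : 'Hom(V, W)) :
  bijective f -> lker f == 0%VS.
Proof. by move=> /bij_inj/lker0P. Qed.

Lemma bijective_lfunVK (V W : vectType R) (f : 'Hom(V, W)) :
  bijective f -> cancel f^-1%VF f.
Proof.
move=> [g fK gK] w; apply: limg_lfunVK.
by rewrite -(gK w) memv_img ?memvf.
Qed.

(** The matrix represents [t p \o F p \o (s p)^-1]: the injective [t p] preserves dimensions and
    [(s p)^-1] is onto, so the image dimension is that of [F p]. *)
Lemma rank_matrix_rep (S : topologicalType) (r r' : nat)
    (E E' : S -> vectType R) (s : forall p, 'Hom(E p, 'rV[R]_r))
    (t : forall p, 'Hom(E' p, 'rV[R]_r')) (F : forall p, 'Hom(E p, E' p)) p :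
  bijective (s p) -> bijective (t p) ->
  \rank (matrix_rep s t F p) = \dim (limg (F p)).
Proof.
move=> sb tb.
have -> : matrix_rep s t F p = lin1_mx (t p \o F p \o (s p)^-1)%VF.
  by apply/matrixP => i j; rewrite !mxE !comp_lfunE.
rewrite rank_lin1_mx !limg_comp.
rewrite limg_dim_eq; last by rewrite (eqP (bijective_lker0 tb)) capv0.
congr (\dim (_ @: _)%VS); apply/eqP; rewrite eqEsubv subvf/=.
apply/subvP => v _; have [_ <-] : v = v /\ (s p)^-1%VF (s p v) = v.
  by split=> //; exact: lker0_lfunK (bijective_lker0 sb) v.
by rewrite memv_img ?memvf.
Qed.

End Minors.

(** * Analytic manifolds and bundles *)

Section Charts.
Variables (R : realType) (n : nat) (S : topologicalType) (c : chart R n S).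

Lemma chart_invK x : (chart_map c @` chart_dom c) x ->
  chart_map c (chart_inv c x) = x.
Proof. by move=> [p cp <-]; rewrite chart_mapK. Qed.

Lemma chart_dom_near p : chart_dom c p -> \forall q \near p, chart_dom c q.
Proof.
by move=> cp; apply: open_nbhs_nbhs; split=> //; exact: chart_dom_open.
Qed.

Lemma chart_codom_near p : chart_dom c p ->
  \forall x \near chart_map c p, (chart_map c @` chart_dom c) x.
Proof.
move=> cp; apply: open_nbhs_nbhs; split; first exact: chart_codom_open.
by exists p.
Qed.

Lemma chart_map_cvg p : chart_dom c p ->
  chart_map c x @[x --> p] --> chart_map c p.
Proof.
move=> cp; have := @chart_map_continuous _ _ _ c.
rewrite continuous_open_subspace; last exact: chart_dom_open.
by apply; exact: mem_set.
Qed.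

Lemma chart_inv_cvg p : chart_dom c p ->
  chart_inv c x @[x --> chart_map c p] --> p.
Proof.
move=> cp; have := @chart_inv_continuous _ _ _ c.
rewrite continuous_open_subspace; last exact: chart_codom_open.
have cm : chart_map c p \in chart_map c @` chart_dom c.
  by apply: mem_set; exists p.
by move=> /(_ _ cm); rewrite /continuous_at chart_mapK.
Qed.

Lemma near_chart_inv p (P : set S) : chart_dom c p ->
  (\forall q \near p, P q) -> \forall x \near chart_map c p, P (chart_inv c x).
Proof. by move=> /chart_inv_cvg; apply. Qed.

End Charts.

(** The first-order expansion, which determines the differential, involves only the germ at [x].
    This suits composites of charts, which are the identity only locally. *)
Lemma near_eq_diff (R : numFieldType) (V W : normedModType R) (f g : V -> W) x :
  (\forall y \near x, f y = g y) -> differentiable g x ->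
  'd f x = 'd g x :> (V -> W).
Proof.
move=> fg dg; apply: diff_unique; first exact: diff_continuous.
have := diff_locally dg; rewrite -(nbhs_singleton fg) => /eqaddoP gE.
apply/eqaddoP => e e0; have := gE e e0.
move: fg; rewrite (near_shift 0 x) subr0; apply: filterS2 => h /= fgh.
by rewrite -![(_ + _ : _ -> _) _]/(_ + _) /= fgh.
Qed.

Section Manifold.
Variables (R : realType) (n : nat) (S : topologicalType).
Variable M : analytic_manifold R n S.

Lemma transition_differentiable (i j : chart_idx M) p :
  chart_dom (mchart i) p -> chart_dom (mchart j) p ->
  differentiable (chart_map (mchart j) \o chart_inv (mchart i))
    (chart_map (mchart i) p).
Proof.
move=> ip jp; apply: analytic_map_at_differentiable.
exact: transition_analytic.
Qed.

(** Chain rule for the two opposite transition maps, whose composite is the identity near the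
    point. *)
Lemma transition_diffK (i j : chart_idx M) p :
  chart_dom (mchart i) p -> chart_dom (mchart j) p ->
  cancel ('d (chart_map (mchart j) \o chart_inv (mchart i))
            (chart_map (mchart i) p))
         ('d (chart_map (mchart i) \o chart_inv (mchart j))
            (chart_map (mchart j) p)).
Proof.
move=> ip jp v.
set f := chart_map (mchart j) \o _; set g := chart_map (mchart i) \o _.
set x := chart_map (mchart i) p; set y := chart_map (mchart j) p.
have fx : f x = y by rewrite /f/= chart_mapK.
have df : differentiable f x by exact: transition_differentiable.
have dg : differentiable g (f x).
  by rewrite fx; exact: transition_differentiable.
have gfE : \forall z \near x, (g \o f) z = id z.
  near=> z; rewrite /g /f /= chart_mapK; last first.
    by near: z; apply: near_chart_inv => //; exact: chart_dom_near.
  by apply: chart_invK; near: z; exact: chart_codom_near.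
have idx : is_diff x (id : 'rV[R]_n -> 'rV[R]_n) id by exact: is_diff_id.
have gf1 := etrans (near_eq_diff gfE (@ex_diff _ _ _ _ _ _ _ idx))
  (@diff_val _ _ _ _ _ _ _ idx).
have /(congr1 (fun h => h v)) := etrans (esym (diff_comp df dg)) gf1.
by rewrite fx.
Unshelve. all: by end_near. Qed.

Lemma chart_diff_bijective (i : chart_idx M) p : chart_dom (mchart i) p ->
  bijective (chart_diff i p).
Proof.
move=> ip; have cp := chart_atP M p.
exists ('d (chart_map (mchart (chart_at M p)) \o chart_inv (mchart i))
  (chart_map (mchart i) p)) => v; rewrite /chart_diff lfunE.
  exact: transition_diffK.
exact: (@transition_diffK i (chart_at M p)).
Qed.

(** Near [p], [f] is its chart expression, continuous because differentiable, composed with the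
    chart map. *)
Lemma analytic_on_continuous (U : set S) (f : S -> R) p :
  analytic_on M U f -> U p -> f x @[x --> p] --> f p.
Proof.
move=> fU /fU[i ip /nbhs_singleton].
set c := mchart i => /analytic_at_differentiable/differentiable_continuous.
rewrite /prop_for /continuous_at /= (chart_mapK ip) => fc.
apply: cvg_trans (cvg_comp _ _ (chart_map_cvg ip) fc).
apply: near_eq_cvg; near=> q; rewrite /= chart_mapK//.
by near: q; exact: chart_dom_near.
Unshelve. all: by end_near. Qed.

(** Local equations are given around every point of [S]; at a point outside [A] one of them is
    nonzero, and stays so nearby by continuity. *)
Lemma analytic_subset_closed (A : set S) : analytic_subset M A -> closed A.
Proof.
move=> anA; rewrite -openC openE => p /= Ap.
have [U [N [g [Uo Up gU AU]]]] := anA p.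
have [i gip] : exists i, g i p != 0.
  apply/not_existsP => g0; apply: Ap; suff [] : (A `&` U) p by [].
  rewrite AU; split=> // i; apply/eqP; have /negP := g0 i; by rewrite negbK.
have gi := analytic_on_continuous (gU i) Up.
rewrite /interior; near=> q => Aq.
have Uq : U q by near: q; exact: open_nbhs_nbhs.
have : (A `&` U) q by [].
rewrite AU => -[_ /(_ i)]; apply/eqP; near: q.
apply: (gi [set x | x != 0]); apply: open_nbhs_nbhs.
by split=> //; exact: open_neq.
Unshelve. all: by end_near. Qed.

(** * Atlas trivializations as analytic frames *)

Section Trivialization.
Variables (r : nat) (E : S -> vectType R) (B : bundle_atlas r E).

(** Only the germ matters, so agreement with [G] over [U] suffices: vectors near
    [row_mx (chart_map (mchart i) q) v] have their first block near the chart image of [q], hence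
    lie over [U]. *)
Lemma local_rep_near (r1 r2 : nat) (E1 E2 : S -> vectType R)
    (B1 : bundle_atlas r1 E1) (B2 : bundle_atlas r2 E2)
    (F : forall p, 'Hom(E1 p, E2 p)) (G : 'rV[R]_(n + r1) -> 'rV[R]_r2)
    (i : chart_idx M) e1 e2 (U : set S) q v :
  open U -> U q -> chart_dom (mchart i) q ->
  (forall w, U (chart_inv (mchart i) (lsubmx w)) ->
    local_rep F i e1 e2 w = G w) ->
  analytic_map_at G (row_mx (chart_map (mchart i) q) v) ->
  analytic_map_at (@local_rep R n S M r1 r2 E1 E2 B1 B2 F i e1 e2)
    (row_mx (chart_map (mchart i) q) v).
Proof.
move=> Uo Uq iq FG Gan j; apply: analytic_at_near (Gan j).
have /nbhs_ballP[e /= e0 eU] : \forall x \near chart_map (mchart i) q,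
    U (chart_inv (mchart i) x).
  by apply: near_chart_inv => //; exact: open_nbhs_nbhs.
apply/nbhs_ballP; exists e => //= w [_ w_ball]; rewrite FG//.
apply: eU; split=> // k l; have := w_ball k (lshift r1 l).
by rewrite row_mxEl mxE.
Qed.

(* In the trivialization e itself, both e and its inverse read (x, v) |-> v. *)
Lemma atlas_local_trivialization (e : triv_idx B) (U : set S) :
  open U -> U `<=` triv_dom e -> (forall p, U p -> bijective (triv e p)) ->
  local_trivialization M B U (triv e).
Proof.
move=> Uo Ue ebij.
have snd_an w : analytic_map_at (fun w : 'rV[R]_(n + r) => rsubmx w) w.
  move=> j; under eq_fun do rewrite mxE; exact: analytic_at_coord.
split=> // p Up; exists (chart_at M p).
  exists e, tt; split=> //; [exact: chart_atP|exact: Ue|].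
  near=> q => v; apply: (local_rep_near (U := U) _ _ _ _ (snd_an _)) => //.
  - by near: q; exact: open_nbhs_nbhs.
  - by near: q; apply: chart_dom_near; exact: chart_atP.
  - move=> w /ebij sb; rewrite /local_rep /= id_lfunE.
    exact: bijective_lfunVK.
exists tt, e; split=> //; [exact: chart_atP|exact: Ue|].
near=> q => v; apply: (local_rep_near (U := U) _ _ _ _ (snd_an _)) => //.
- by near: q; exact: open_nbhs_nbhs.
- by near: q; apply: chart_dom_near; exact: chart_atP.
- move=> w /ebij sb; rewrite /local_rep /= bijective_lfunVK//.
  (* The frame of the product bundle is the identity, whose formal inverse must still be
     simplified. *)
  have idb : bijective (\1%VF : 'Hom('rV[R]_r, 'rV[R]_r)).
    by exists id => u; rewrite id_lfunE.
  by have := bijective_lfunVK idb (rsubmx w); rewrite id_lfunE.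
Unshelve. all: by end_near. Qed.

End Trivialization.

(** * Minors of the morphism in local frames *)

Lemma matrix_rep_analytic (r r' : nat) (E E' : S -> vectType R)
    (B : bundle_atlas r E) (B' : bundle_atlas r' E')
    (F : forall p, 'Hom(E p, E' p)) (i : chart_idx M) e e' x a b :
  (forall v, analytic_map_at (@local_rep R n S M r r' E E' B B' F i e e')
     (row_mx x v)) ->
  analytic_at ((fun p => matrix_rep (triv e) (triv e') F p a b)
    \o chart_inv (mchart i)) x.
Proof.
move=> Fan; have := analytic_at_row_mx (Fan (delta_mx 0 a) b).
congr analytic_at; apply/funext => y.
by rewrite /local_rep /matrix_rep /= mxE row_mxKl row_mxKr.
Qed.

Lemma degeneracy_locus_minors (r r' : nat) (E E' : S -> vectType R)
    (F : forall p, 'Hom(E p, E' p)) k (U : set S)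
    (s : forall p, 'Hom(E p, 'rV[R]_r)) (t : forall p, 'Hom(E' p, 'rV[R]_r')) :
  (forall p, U p -> bijective (s p)) -> (forall p, U p -> bijective (t p)) ->
  degeneracy_locus F k `&` U = [set q | U q /\
    forall (f : 'I_k.+1 -> 'I_r) (g : 'I_k.+1 -> 'I_r'),
      increasing f -> increasing g -> minor f g (matrix_rep s t F q) = 0].
Proof.
move=> sb tb; apply/seteqP; split=> q /=.
  by move=> [Fq Uq]; split=> //; apply/rank_le_minorsP;
    rewrite rank_matrix_rep; [|exact: sb|exact: tb].
move=> [Uq /rank_le_minorsP]; rewrite rank_matrix_rep; first by [].
  exact: sb.
exact: tb.
Qed.

End Manifold.

(** The frames are the chart differential and the bundle trivialization in which the analyticity of
    [Resp] near [p] is expressed. *)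
Lemma analytic_local_minors (R : realType) (n m : nat) (S : topologicalType)
    (M : analytic_manifold R n S) (Z : S -> vectType R)
    (ZB : vector_bundle M m Z)
    (Resp : forall p : S, 'Hom(@tangent_space R n S p, Z p)) k (p : S) :
  analytic_morphism M (tangent_atlas M) ZB Resp ->
  exists (U : set S)
    (s : forall q : S, 'Hom(@tangent_space R n S q, 'rV[R]_n))
    (t : forall q : S, 'Hom(Z q, 'rV[R]_m)),
  [/\ U p, local_trivialization M (tangent_atlas M) U s,
      local_trivialization M ZB U t &
      forall (f : 'I_k -> 'I_n) (g : 'I_k -> 'I_m),
        analytic_on M U (fun q => minor f g (matrix_rep s t Resp q))].
Proof.
move=> hResp; have [i [e [e' [ip ep ep' Fan]]]] := hResp p I.
pose W := [set q | forall v, analytic_map_at (@local_rep R n S M n m _ _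
  (tangent_atlas M) ZB Resp i e e') (row_mx (chart_map (mchart i) q) v)].
(* Passing to the interior gives an open set at all of whose points the same local representative is
   analytic. *)
pose U := interior W `&` chart_dom (mchart i) `&` (triv_dom e `&` triv_dom e').
have Uo : open U.
  apply: openI; apply: openI; [exact: open_interior|exact: chart_dom_open| |].
    exact: chart_dom_open.
  exact: vb_open.
exists U, (triv e), (triv e'); split.
- by [].
- apply: atlas_local_trivialization => // q [_ []]// + _.
  exact: chart_diff_bijective.
- by apply: atlas_local_trivialization => // q [_ []]// _; exact: vb_bijective.
move=> f g q Uq; have [[_ iq] _] := Uq; exists i => //.
have : \forall q' \near q, U q' by exact: open_nbhs_nbhs.
apply: filterS => q' [[Wq' _] _].
have {}Wq' := interior_subset Wq'.
apply: analytic_at_det => a b; under eq_fun do rewrite mxE.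
exact: matrix_rep_analytic.
Qed.

Theorem proposition2p6 (R : realType) (n m : nat) (S : topologicalType)
    (M : analytic_manifold R n S) (Z : S -> vectType R)
    (ZB : vector_bundle M m Z)
    (Resp : forall p : S, 'Hom(@tangent_space R n S p, Z p))
    (hResp : analytic_morphism M (tangent_atlas M) ZB Resp)
    (k : nat) (hk : (k <= minn n m)%N) :
  [/\ closed (degeneracy_locus Resp k),
      analytic_subset M (degeneracy_locus Resp k),
      forall p : S, exists (U : set S)
          (s : forall q : S, 'Hom(@tangent_space R n S q, 'rV[R]_n))
          (t : forall q : S, 'Hom(Z q, 'rV[R]_m)),
        [/\ U p,
            local_trivialization M (tangent_atlas M) U s,
            local_trivialization M ZB U t &
            forall (f : 'I_k.+1 -> 'I_n) (g : 'I_k.+1 -> 'I_m),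
              increasing f -> increasing g ->
              analytic_on M U (fun q => minor f g (matrix_rep s t Resp q))] &
      forall (U : set S)
          (s : forall q : S, 'Hom(@tangent_space R n S q, 'rV[R]_n))
          (t : forall q : S, 'Hom(Z q, 'rV[R]_m)),
        local_trivialization M (tangent_atlas M) U s ->
        local_trivialization M ZB U t ->
        degeneracy_locus Resp k `&` U =
          [set q | U q /\
             forall (f : 'I_k.+1 -> 'I_n) (g : 'I_k.+1 -> 'I_m),
               increasing f -> increasing g ->
               minor f g (matrix_rep s t Resp q) = 0]].
Proof.
(* The last conclusion comes first, since it also supplies the local equations of the analytic
   subset. *)
have locus (U : set S) s t : local_trivialization M (tangent_atlas M) U s ->
    local_trivialization M ZB U t ->
    degeneracy_locus Resp k `&` U = [set q | U q /\
      forall (f : 'I_k.+1 -> 'I_n) (g : 'I_k.+1 -> 'I_m),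
        increasing f -> increasing g -> minor f g (matrix_rep s t Resp q) = 0].
  by move=> [_ sb _ _] [_ tb _ _]; exact: degeneracy_locus_minors.
have an_subset : analytic_subset M (degeneracy_locus Resp k).
  move=> p.
  have [U [s [t [Up sU tU an]]]] := analytic_local_minors k.+1 p hResp.
  have [Uo sb _ _] := sU; have [_ tb _ _] := tU.
  (* Pairs of finite functions form a finite type, so all minors can be numbered as one finite list
     of equations. Choices that are not increasing are harmless: their minors also vanish on the
     locus. *)
  pose I := ({ffun 'I_k.+1 -> 'I_n} * {ffun 'I_k.+1 -> 'I_m})%type.
  pose fg (i : 'I_#|{: I}|) : I := enum_val i.
  exists U, #|{: I}|, (fun i q => minor (fg i).1 (fg i).2
    (matrix_rep s t Resp q)).
  split=> //; apply/seteqP; split=> q /=.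
    move=> [Dq Uq]; split=> // i; apply: minor_rank_le.
    by rewrite rank_matrix_rep; [exact: Dq|exact: sb|exact: tb].
  move=> [Uq minors0]; suff : (degeneracy_locus Resp k `&` U) q by [].
  rewrite (locus U s t)//; split=> // f g _ _.
  have := minors0 (enum_rank ((finfun f, finfun g) : I)).
  rewrite /fg enum_rankK /=.
  by congr (_ = _); congr (\det _); apply/matrixP => a b; rewrite !mxE !ffunE.
split=> //; first exact: (analytic_subset_closed an_subset).
move=> p; have [U [s [t [Up sU tU an]]]] := analytic_local_minors k.+1 p hResp.
by exists U, s, t; split=> // f g _ _; exact: an.
Qed.
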